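(* Let $H = (H,\mu_H,\Delta_H,\alpha_H)$ be a Hom-bialgebra, let $C = (C,\Delta_C,\alpha_C)$ be a Hom-coassociative coalgebra, and let $\delta \colon C\to H \otimes C$ be an $H$-comodule structure on the Hom-module $(C,\alpha_C)$. Then the following statements hold. (1) The map $$\widetilde{\delta} = (\alpha_H^2 \otimes \mathrm{id}_C)\circ\delta \colon C \to H \otimes C$$ gives $(C,\alpha_C)$ another $H$-comodule structure. (2) The map $$\delta_{CC} = (\mu_H \otimes \mathrm{id}_C^{\otimes 2}) \circ (\mathrm{id}_H \otimes \tau_{C,H} \otimes \mathrm{id}_C) \circ \delta^{\otimes 2} \colon C^{\otimes 2} \to H \otimes C^{\otimes 2}$$ gives $(C^{\otimes 2},\alpha_C^{\otimes 2})$ an $H$-comodule structure. (3) The map $\delta$ gives $C$ the structure of an $H$-comodule Hom-coalgebra if and only if $\Delta_C \colon C\to C^{\otimes 2}$ is a morphism of $H$-comodules, where $C^{\otimes 2}$ is equipped with the $H$-comodule structure $\delta_{CC}$ and $C$ is equipped with the $H$-comodule structure $\widetilde{\delta}$.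
   Context: Vector spaces and linear maps are over a field $\mathbb{F}$ of any characteristic. For vector spaces $U,V$, $\tau_{U,V}\colon U\otimes V\to V\otimes U$ is the twist map $u\otimes v\mapsto v\otimes u$. A Hom-module is a pair $(V,\alpha)$ with $V$ a vector space and $\alpha\colon V\to V$ linear; a morphism $(V,\alpha_V)\to(W,\alpha_W)$ is a linear map $f$ with $\alpha_W\circ f=f\circ\alpha_V$. The tensor product of $(V,\alpha_V)$ and $(W,\alpha_W)$ is $(V\otimes W,\alpha_V\otimes\alpha_W)$. A Hom-associative algebra is a triple $(A,\mu,\alpha)$ with $(A,\alpha)$ a Hom-module and $\mu\colon A\otimes A\to A$ linear such that $\alpha\circ\mu=\mu\circ\alpha^{\otimes 2}$ and $\mu\circ(\alpha\otimes\mu)=\mu\circ(\mu\otimes\alpha)$. No unit is required. A Hom-coassociative coalgebra is a triple $(C,\Delta,\alpha)$ with $(C,\alpha)$ a Hom-module and $\Delta\colon C\to C\otimes C$ linear such that $\Delta\circ\alpha=\alpha^{\otimes 2}\circ\Delta$ and $(\alpha\otimes\Delta)\circ\Delta=(\Delta\otimes\alpha)\circ\Delta$. No counit is required. A Hom-bialgebra is a quadruple $(H,\mu,\Delta,\alpha)$ such that $(H,\mu,\alpha)$ is a Hom-associative algebra, $(H,\Delta,\alpha)$ is a Hom-coassociative coalgebra, and $\Delta$ is a morphism of Hom-associative algebras, i.e. $\Delta\circ\mu=\mu^{\otimes 2}\circ(\mathrm{id}_H\otimes\tau_{H,H}\otimes\mathrm{id}_H)\circ\Delta^{\otimes 2}$.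 Let $(D,\Delta_D,\alpha_D)$ be a Hom-coassociative coalgebra and $(M,\alpha_M)$ a Hom-module. A $D$-comodule structure on $M$ is a linear map $\delta\colon M\to D\otimes M$ that is a morphism of Hom-modules, i.e. $\delta\circ\alpha_M=(\alpha_D\otimes\alpha_M)\circ\delta$, and satisfies $(\alpha_D\otimes\delta)\circ\delta=(\Delta_D\otimes\alpha_M)\circ\delta$. A morphism of $D$-comodules $f\colon (M,\delta_M)\to (N,\delta_N)$ is a morphism of Hom-modules with $\delta_N\circ f=(\mathrm{id}_D\otimes f)\circ\delta_M$. For a Hom-bialgebra $H$, an $H$-comodule is a comodule over the Hom-coassociative coalgebra $(H,\Delta_H,\alpha_H)$. For a Hom-bialgebra $(H,\mu_H,\Delta_H,\alpha_H)$ and a Hom-coassociative coalgebra $(C,\Delta_C,\alpha_C)$, an $H$-comodule Hom-coalgebra structure on $C$ is an $H$-comodule structure $\delta\colon C\to H\otimes C$ on $(C,\alpha_C)$ such that $(\alpha_H^2\otimes\Delta_C)\circ\delta=\delta_{CC}\circ\Delta_C$, where $\delta_{CC}\colon C\otimes C\to H\otimes C\otimes C$ is given by $\delta_{CC}(c\otimes d)=\sum c_{(-1)}d_{(-1)}\otimes c_{(0)}\otimes d_{(0)}$, with $\delta(c)=\sum c_{(-1)}\otimes c_{(0)}$ and the product taken with $\mu_H$. *)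

(* Defs.v *)
From HB Require Import structures.
From mathcomp Require Import all_boot all_algebra.
From mathcomp Require Import sesquilinear boolp.
From mathcomp.multinomials Require Import freeg.

Set Implicit Arguments.
Unset Strict Implicit.
Unset Printing Implicit Defensive.

Import GRing.Theory.
Local Open Scope ring_scope.
Local Open Scope quotient_scope.

Reserved Notation "U ⊗ V" (at level 40, left associativity).
Reserved Notation "u ⊗ₜ v" (at level 40, left associativity).
Reserved Notation "f ⊗ₗ g" (at level 40, left associativity).

(* MathComp has no tensor product of (possibly infinite-dimensional) vector
   spaces, so U ⊗ V is constructed as the quotient of the free vector space on
   U * V by the subspace spanned by the bilinearity relations.
   tens_lift, tens_liftE and tens_linear_ext give its universal property. *)
Section TensorConstruction.
Variables (F : fieldType) (U V : lmodType F).

Definition tens_free : lmodType F := {freeg (U * V)%type / F}.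

Definition tens_gen (u : U) (v : V) : tens_free :=
  Freeg [:: (1 : F, (u, v))].

Inductive tens_rel : tens_free -> Prop :=
| tens_relDl u u' v :
    tens_rel (tens_gen (u + u') v - (tens_gen u v + tens_gen u' v))
| tens_relDr u v v' :
    tens_rel (tens_gen u (v + v') - (tens_gen u v + tens_gen u v'))
| tens_relZl a u v : tens_rel (tens_gen (a *: u) v - a *: tens_gen u v)
| tens_relZr a u v : tens_rel (tens_gen u (a *: v) - a *: tens_gen u v)
| tens_rel0 : tens_rel 0
| tens_relD x y : tens_rel x -> tens_rel y -> tens_rel (x + y)
| tens_relZ a x : tens_rel x -> tens_rel (a *: x).

Definition tens_relb : pred tens_free := fun x => `[< tens_rel x >].

Lemma tens_relb_zmod_closed : zmod_closed tens_relb.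
Proof.
split=> [|x y /asboolP xr /asboolP yr]; apply/asboolP; first exact: tens_rel0.
by apply: tens_relD => //; rewrite -scaleN1r; apply: tens_relZ.
Qed.
Definition tens_relz : zmodClosed tens_free := HB.pack tens_relb
  (GRing.isZmodClosed.Build tens_free tens_relb tens_relb_zmod_closed).

Definition tens : Type := Quotient.quot tens_relz.
HB.instance Definition _ := GRing.Zmodule.on tens.

Definition tens_class (x : tens_free) : tens :=
  \pi_(Quotient.quot tens_relz) x.

Fact tens_class_zmod_morphism : zmod_morphism tens_class.
Proof. exact: raddfB. Qed.
HB.instance Definition _ :=
  GRing.isZmodMorphism.Build tens_free tens tens_class tens_class_zmod_morphism.

Definition tens_repr (x : tens) : tens_free :=
  repr (x : Quotient.quot tens_relz).

Lemma tens_reprK : cancel tens_repr tens_class.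
Proof. exact: reprK. Qed.

Lemma tens_classP x y : tens_class x = tens_class y <-> tens_rel (x - y).
Proof.
have E : (x - y \in tens_relz) = (tens_class x == tens_class y).
  exact: Quotient.idealrBE.
split=> [/eqP|h]; first by rewrite -E => /asboolP.
by apply/eqP; rewrite -E; apply/asboolP.
Qed.

Definition tens_scale (a : F) (x : tens) : tens := tens_class (a *: tens_repr x).

Lemma tens_scale_class a x : tens_scale a (tens_class x) = tens_class (a *: x).
Proof.
apply/tens_classP; rewrite -scalerBr; apply: tens_relZ.
by apply/tens_classP; rewrite tens_reprK.
Qed.

Fact tens_scaleA a b x : tens_scale a (tens_scale b x) = tens_scale (a * b) x.
Proof. by rewrite -[x]tens_reprK !tens_scale_class scalerA. Qed.
Fact tens_scale1 : left_id 1 tens_scale.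
Proof. by move=> x; rewrite -[x]tens_reprK tens_scale_class scale1r. Qed.
Fact tens_scaleDr : right_distributive tens_scale +%R.
Proof.
move=> a x y; rewrite -[x]tens_reprK -[y]tens_reprK.
by rewrite -raddfD !tens_scale_class scalerDr raddfD.
Qed.
Fact tens_scaleDl x : {morph tens_scale^~ x : a b / a + b}.
Proof.
by move=> a b; rewrite -[x]tens_reprK !tens_scale_class scalerDl raddfD.
Qed.
HB.instance Definition _ := GRing.Zmodule_isLmodule.Build F tens
  tens_scaleA tens_scale1 tens_scaleDr tens_scaleDl.

Fact tens_class_scalable : scalable tens_class.
Proof. by move=> a x; rewrite -tens_scale_class. Qed.
HB.instance Definition _ :=
  GRing.isScalable.Build F tens_free tens *:%R tens_class tens_class_scalable.

Definition tpure (u : U) (v : V) : tens := tens_class (tens_gen u v).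

Fact tpure_bilinear : bilinear_for *:%R *:%R tpure.
Proof.
split=> [v|u] a x y; rewrite /tpure -linearZ -linearD /=; apply/tens_classP.
- rewrite -[X in tens_rel X](subrKA (tens_gen (a *: x) v + tens_gen y v)).
  apply: tens_relD; first exact: tens_relDl.
  by rewrite [a *: _ + _]addrC addrKA; exact: tens_relZl.
- rewrite -[X in tens_rel X](subrKA (tens_gen u (a *: x) + tens_gen u y)).
  apply: tens_relD; first exact: tens_relDr.
  by rewrite [a *: _ + _]addrC addrKA; exact: tens_relZr.
Qed.
HB.instance Definition _ := bilinear_isBilinear.Build F U V tens *:%R *:%R
  tpure tpure_bilinear.

Lemma tens_ind (P : tens -> Prop) :
    (forall u v, P (tpure u v)) ->
    (forall x y, P x -> P y -> P (x + y)) ->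
    (forall a x, P x -> P (a *: x)) ->
  forall x, P x.
Proof.
move=> Ppure PD PZ x.
have P0 : P 0 by rewrite -(scale0r (tpure 0 0)); apply/PZ/Ppure.
rewrite -[x]tens_reprK -[tens_repr x]freeg_sumE linear_sum.
elim/big_ind: _ => // -[u v] _.
set c := coeff _ _.
suff -> : Freeg [:: (c, (u, v))] = c *: tens_gen u v :> tens_free.
  by rewrite linearZ; apply/PZ/Ppure.
by apply/eqP/freeg_eqP => k; rewrite coeffZ /tens_gen !coeffU mul1r.
Qed.

Section Lift.
Variables (W : lmodType F) (f : {bilinear U -> V -> W}).

Let lift_free (x : tens_free) : W := fglift (fun p => f p.1 p.2) x.

Let lift_free_gen u v : lift_free (tens_gen u v) = f u v.
Proof. by rewrite /lift_free liftU scale1r. Qed.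

Let lift_freeB x y : lift_free (x - y) = lift_free x - lift_free y.
Proof. exact: lift_is_additive. Qed.

Let lift_free0 : lift_free 0 = 0.
Proof. by rewrite -(subrr (0 : tens_free)) lift_freeB subrr. Qed.

Let lift_freeD x y : lift_free (x + y) = lift_free x + lift_free y.
Proof.
by rewrite -{1}[y]opprK lift_freeB -[- y]sub0r lift_freeB lift_free0 sub0r opprK.
Qed.

Let lift_freeZ a x : lift_free (a *: x) = a *: lift_free x.
Proof.
have gen c p : lift_free (Freeg [:: (c, p)]) = c *: f p.1 p.2.
  by rewrite /lift_free liftU.
have sum I (r : seq I) (G : I -> tens_free) :
    lift_free (\sum_(i <- r) G i) = \sum_(i <- r) lift_free (G i).
  exact: (big_morph _ lift_freeD lift_free0).
rewrite -[x]freeg_sumE scaler_sumr !sum scaler_sumr; apply: eq_bigr => p _.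
rewrite gen scalerA -gen; congr lift_free.
by apply/eqP/freeg_eqP => k; rewrite coeffZ !coeffU mulrA.
Qed.

Let lift_free_rel x : tens_rel x -> lift_free x = 0.
Proof.
elim=> {x} [u u' v|u v v'|a u v|a u v||x y _ xE _ yE|a x _ xE].
- by rewrite lift_freeB lift_freeD !lift_free_gen linearDl subrr.
- by rewrite lift_freeB lift_freeD !lift_free_gen linearDr subrr.
- by rewrite lift_freeB lift_freeZ !lift_free_gen linearZl_LR subrr.
- by rewrite lift_freeB lift_freeZ !lift_free_gen linearZr_LR subrr.
- exact: lift_free0.
- by rewrite lift_freeD xE yE addr0.
- by rewrite lift_freeZ xE scaler0.
Qed.

Definition tens_lift (x : tens) : W :=
  fglift (fun p => f p.1 p.2) (tens_repr x).

Let tens_lift_class x : tens_lift (tens_class x) = lift_free x.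
Proof.
apply/eqP; rewrite -subr_eq0 -[_ - _]lift_freeB; apply/eqP/lift_free_rel.
by apply/tens_classP; rewrite tens_reprK.
Qed.

Fact tens_lift_linear : linear tens_lift.
Proof.
move=> a x y; rewrite -[x]tens_reprK -[y]tens_reprK -linearZ -linearD.
by rewrite !tens_lift_class lift_freeD lift_freeZ.
Qed.
HB.instance Definition _ :=
  GRing.isLinear.Build F tens W *:%R tens_lift tens_lift_linear.

Lemma tens_liftE u v : tens_lift (tpure u v) = f u v.
Proof. by rewrite tens_lift_class lift_free_gen. Qed.

End Lift.

Lemma tens_linear_ext (W : lmodType F) (f g : {linear tens -> W}) :
  (forall u v, f (tpure u v) = g (tpure u v)) -> f =1 g.
Proof.
move=> fg; elim/tens_ind => // [x y xE yE|a x xE].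
  by rewrite !linearD xE yE.
by rewrite !linearZ xE.
Qed.

End TensorConstruction.

Arguments tens {F} U V.
Arguments tpure {F U V} u v.

Notation "U ⊗ V" := (tens U%type V%type) : type_scope.
Notation "u ⊗ₜ v" := (tpure u v) : ring_scope.

Section TensorMaps.
Variable F : fieldType.

Section Map.
Variables (U U' V V' : lmodType F).
Variables (f : {linear U -> U'}) (g : {linear V -> V'}).

Definition tens_map_fun (u : U) (v : V) : U' ⊗ V' := f u ⊗ₜ g v.
Fact tens_map_fun_bilinear : bilinear_for *:%R *:%R tens_map_fun.
Proof.
by split=> [v|u] a x y; rewrite /tens_map_fun linearP ?linearPl ?linearPr.
Qed.
HB.instance Definition _ := bilinear_isBilinear.Build F U V (U' ⊗ V')%type
  *:%R *:%R tens_map_fun tens_map_fun_bilinear.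

Definition tens_map : {linear U ⊗ V -> U' ⊗ V'} := tens_lift tens_map_fun.

Lemma tens_mapE u v : tens_map (u ⊗ₜ v) = f u ⊗ₜ g v.
Proof. exact: tens_liftE. Qed.

End Map.

Section Twist.
Variables (U V : lmodType F).

Definition twist_fun (u : U) (v : V) : V ⊗ U := v ⊗ₜ u.
Fact twist_fun_bilinear : bilinear_for *:%R *:%R twist_fun.
Proof. by split=> [v|u] a x y; rewrite /twist_fun ?linearPl ?linearPr. Qed.
HB.instance Definition _ := bilinear_isBilinear.Build F U V (V ⊗ U)%type
  *:%R *:%R twist_fun twist_fun_bilinear.

Definition twist : {linear U ⊗ V -> V ⊗ U} := tens_lift twist_fun.

Lemma twistE u v : twist (u ⊗ₜ v) = v ⊗ₜ u.
Proof. exact: tens_liftE. Qed.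

End Twist.
Section Associator.
Variables (U V W : lmodType F).

Section LeftToRight.

Definition tens_assoc_fun2 (w : W) (u : U) (v : V) : U ⊗ (V ⊗ W) :=
  u ⊗ₜ (v ⊗ₜ w).
Fact tens_assoc_fun2_bilinear w :
  bilinear_for *:%R *:%R (tens_assoc_fun2 w).
Proof.
by split=> [v|u] a x y; rewrite /tens_assoc_fun2 ?linearPl ?linearPr.
Qed.
HB.instance Definition _ w := bilinear_isBilinear.Build F U V
  (U ⊗ (V ⊗ W))%type *:%R *:%R (tens_assoc_fun2 w)
  (tens_assoc_fun2_bilinear w).

Definition tens_assoc_fun (x : U ⊗ V) (w : W) : U ⊗ (V ⊗ W) :=
  tens_lift (tens_assoc_fun2 w) x.
Fact tens_assoc_fun_bilinear : bilinear_for *:%R *:%R tens_assoc_fun.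
Proof.
split=> [w|x] a y z; rewrite /tens_assoc_fun ?linearP //.
elim/tens_ind: x => [u v|x x' xE x'E|b x xE].
- by rewrite !tens_liftE /= /tens_assoc_fun2 !linearPr.
- by rewrite !linearD /= xE x'E scalerDr addrACA.
- by rewrite !linearZ /= xE scalerDr !scalerA mulrC.
Qed.
HB.instance Definition _ := bilinear_isBilinear.Build F (U ⊗ V)%type W
  (U ⊗ (V ⊗ W))%type *:%R *:%R tens_assoc_fun tens_assoc_fun_bilinear.

Definition tens_assoc : {linear (U ⊗ V) ⊗ W -> U ⊗ (V ⊗ W)} :=
  tens_lift tens_assoc_fun.

Lemma tens_assocE u v w : tens_assoc ((u ⊗ₜ v) ⊗ₜ w) = u ⊗ₜ (v ⊗ₜ w).
Proof. by rewrite [LHS]tens_liftE [LHS]tens_liftE. Qed.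

End LeftToRight.

Section RightToLeft.

Definition tens_unassoc_fun2 (u : U) (v : V) (w : W) : (U ⊗ V) ⊗ W :=
  (u ⊗ₜ v) ⊗ₜ w.
Fact tens_unassoc_fun2_bilinear u :
  bilinear_for *:%R *:%R (tens_unassoc_fun2 u).
Proof.
by split=> [w|v] a x y; rewrite /tens_unassoc_fun2 ?linearPr ?linearPl.
Qed.
HB.instance Definition _ u := bilinear_isBilinear.Build F V W
  ((U ⊗ V) ⊗ W)%type *:%R *:%R (tens_unassoc_fun2 u)
  (tens_unassoc_fun2_bilinear u).

Definition tens_unassoc_fun (u : U) (x : V ⊗ W) : (U ⊗ V) ⊗ W :=
  tens_lift (tens_unassoc_fun2 u) x.
Fact tens_unassoc_fun_bilinear : bilinear_for *:%R *:%R tens_unassoc_fun.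
Proof.
split=> [x|u] a y z; rewrite /tens_unassoc_fun ?linearP //.
elim/tens_ind: x => [v w|x x' xE x'E|b x xE].
- by rewrite !tens_liftE /= /tens_unassoc_fun2 !linearPl.
- by rewrite !linearD /= xE x'E scalerDr addrACA.
- by rewrite !linearZ /= xE scalerDr !scalerA mulrC.
Qed.
HB.instance Definition _ := bilinear_isBilinear.Build F U (V ⊗ W)%type
  ((U ⊗ V) ⊗ W)%type *:%R *:%R tens_unassoc_fun tens_unassoc_fun_bilinear.

Definition tens_unassoc : {linear U ⊗ (V ⊗ W) -> (U ⊗ V) ⊗ W} :=
  tens_lift tens_unassoc_fun.

Lemma tens_unassocE u v w : tens_unassoc (u ⊗ₜ (v ⊗ₜ w)) = (u ⊗ₜ v) ⊗ₜ w.
Proof. by rewrite [LHS]tens_liftE [LHS]tens_liftE. Qed.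

End RightToLeft.

Lemma tens_assocK : cancel tens_assoc tens_unassoc.
Proof.
elim/tens_ind => [x w|x y xE yE|a x xE]; last 2 first.
- by rewrite !linearD xE yE.
- by rewrite !linearZ xE.
elim/tens_ind: x => [u v|x y xE yE|a x xE].
- by rewrite tens_assocE tens_unassocE.
- by rewrite linearDl !linearD xE yE.
- by rewrite linearZl_LR !linearZ xE.
Qed.

Lemma tens_unassocK : cancel tens_unassoc tens_assoc.
Proof.
elim/tens_ind => [u x|x y xE yE|a x xE]; last 2 first.
- by rewrite !linearD xE yE.
- by rewrite !linearZ xE.
elim/tens_ind: x => [v w|x y xE yE|a x xE].
- by rewrite tens_unassocE tens_assocE.
- by rewrite linearDr !linearD xE yE.
- by rewrite linearZr_LR !linearZ xE.
Qed.

End Associator.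
End TensorMaps.

Arguments twist {F} U V.
Arguments tens_assoc {F} U V W.
Arguments tens_unassoc {F} U V W.

Notation "f ⊗ₗ g" := (tens_map f g) : ring_scope.

(* The informal id_U ⊗ τ_{V,W} ⊗ id_X : (U ⊗ V) ⊗ (W ⊗ X) -> (U ⊗ W) ⊗ (V ⊗ X),
   with the associators that are left implicit on paper. *)
Definition mid_twist (F : fieldType) (U V W X : lmodType F) :
    {linear (U ⊗ V) ⊗ (W ⊗ X) -> (U ⊗ W) ⊗ (V ⊗ X)} :=
  tens_unassoc U W (V ⊗ X)
  \o (idfun ⊗ₗ (tens_assoc W V X \o (twist V W ⊗ₗ idfun) \o tens_unassoc V W X))
  \o tens_assoc U V (W ⊗ X).
Arguments mid_twist {F} U V W X.

Lemma mid_twistE (F : fieldType) (U V W X : lmodType F)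
    (u : U) (v : V) (w : W) (x : X) :
  mid_twist U V W X ((u ⊗ₜ v) ⊗ₜ (w ⊗ₜ x)) = (u ⊗ₜ w) ⊗ₜ (v ⊗ₜ x).
Proof.
rewrite /mid_twist /= tens_assocE tens_mapE /= tens_unassocE.
by rewrite tens_mapE /= twistE tens_assocE tens_unassocE.
Qed.

Section HomStructures.
Variable F : fieldType.

Definition hom_module_morphism (V W : lmodType F)
    (alphaV : {linear V -> V}) (alphaW : {linear W -> W})
    (f : {linear V -> W}) : Prop :=
  alphaW \o f =1 f \o alphaV.

Record hom_assoc_algebra (A : lmodType F)
    (mu : {linear A ⊗ A -> A}) (alpha : {linear A -> A}) : Prop := {
  hom_mul : alpha \o mu =1 mu \o (alpha ⊗ₗ alpha);
  hom_mulA : mu \o (alpha ⊗ₗ mu) \o tens_assoc A A A =1 mu \o (mu ⊗ₗ alpha)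
}.

Record hom_coassoc_coalgebra (C : lmodType F)
    (Delta : {linear C -> C ⊗ C}) (alpha : {linear C -> C}) : Prop := {
  hom_comul : Delta \o alpha =1 (alpha ⊗ₗ alpha) \o Delta;
  hom_comulA :
    (alpha ⊗ₗ Delta) \o Delta =1 tens_assoc C C C \o (Delta ⊗ₗ alpha) \o Delta
}.

Record hom_bialgebra (H : lmodType F) (mu : {linear H ⊗ H -> H})
    (Delta : {linear H -> H ⊗ H}) (alpha : {linear H -> H}) : Prop := {
  hom_bialgebra_algebra : hom_assoc_algebra mu alpha;
  hom_bialgebra_coalgebra : hom_coassoc_coalgebra Delta alpha;
  hom_bialgebra_comulM :
    Delta \o mu =1 (mu ⊗ₗ mu) \o mid_twist H H H H \o (Delta ⊗ₗ Delta)
}.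

Record hom_comodule (D : lmodType F) (DeltaD : {linear D -> D ⊗ D})
    (alphaD : {linear D -> D}) (M : lmodType F) (alphaM : {linear M -> M})
    (delta : {linear M -> D ⊗ M}) : Prop := {
  hom_comodule_morph : hom_module_morphism alphaM (alphaD ⊗ₗ alphaM) delta;
  hom_comoduleA :
    (alphaD ⊗ₗ delta) \o delta
      =1 tens_assoc D D M \o (DeltaD ⊗ₗ alphaM) \o delta
}.

Record hom_comodule_morphism (D M N : lmodType F)
    (alphaM : {linear M -> M}) (deltaM : {linear M -> D ⊗ M})
    (alphaN : {linear N -> N}) (deltaN : {linear N -> D ⊗ N})
    (f : {linear M -> N}) : Prop := {
  hom_comodule_morphism_hom : hom_module_morphism alphaM alphaN f;
  hom_comodule_morphism_coact : deltaN \o f =1 (idfun ⊗ₗ f) \o deltaM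
}.

Definition delta_tilde (H C : lmodType F) (alphaH : {linear H -> H})
    (delta : {linear C -> H ⊗ C}) : {linear C -> H ⊗ C} :=
  ((alphaH \o alphaH) ⊗ₗ idfun) \o delta.

Definition delta_CC (H C : lmodType F) (muH : {linear H ⊗ H -> H})
    (delta : {linear C -> H ⊗ C}) : {linear C ⊗ C -> H ⊗ (C ⊗ C)} :=
  (muH ⊗ₗ idfun) \o mid_twist H C H C \o (delta ⊗ₗ delta).

Record comodule_hom_coalgebra (H C : lmodType F) (muH : {linear H ⊗ H -> H})
    (DeltaH : {linear H -> H ⊗ H}) (alphaH : {linear H -> H})
    (DeltaC : {linear C -> C ⊗ C}) (alphaC : {linear C -> C})
    (delta : {linear C -> H ⊗ C}) : Prop := {
  comodule_hom_coalgebra_comodule : hom_comodule DeltaH alphaH alphaC delta;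
  comodule_hom_coalgebra_comul :
    ((alphaH \o alphaH) ⊗ₗ DeltaC) \o delta =1 delta_CC muH delta \o DeltaC
}.

End HomStructures.

(* Main.v *)
(** For (2), each side of the comodule axiom for [delta_CC] is one fixed
    multiplication (H ⊗ (H ⊗ C)) ⊗ (H ⊗ (H ⊗ C)) -> H ⊗ (H ⊗ (C ⊗ C)) applied to
    two copies of the corresponding side of the axiom for [delta]: on the left
    because alpha_H is multiplicative, on the right because Delta_H is. For (3),
    (id ⊗ Delta_C) \o delta_tilde = (alpha_H^2 ⊗ Delta_C) \o delta, so the two
    compatibility conditions coincide. *)
Require Import Defs.
From mathcomp Require Import all_boot all_algebra.

Import GRing.Theory.

Local Open Scope ring_scope.

Section TensorMapTheory.
Context {F : fieldType}.
Implicit Types U V W X Y : lmodType F.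

(** [mid_twist] computes only on tensors of this shape, whereas [tens_linear_ext] leaves factors in
    [U ⊗ V] and [W ⊗ X] that need not be pure. Induction on each in turn reduces them to pure
    tensors. *)
Lemma tens_linear_ext4 {U V W X Y} (f g : {linear (U ⊗ V) ⊗ (W ⊗ X) -> Y}) :
    (forall u v w x,
      f ((u ⊗ₜ v) ⊗ₜ (w ⊗ₜ x)) = g ((u ⊗ₜ v) ⊗ₜ (w ⊗ₜ x))) ->
  f =1 g.
Proof.
move=> fg; apply: tens_linear_ext; elim/tens_ind => [u v|a b aE bE|k a aE] y.
- elim/tens_ind: y => // [a b aE bE|k a aE].
    by rewrite linearDr !linearD aE bE.
  by rewrite linearZr_LR !linearZ aE.
- by rewrite linearDl !linearD aE bE.
- by rewrite linearZl_LR !linearZ aE.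
Qed.

Lemma tens_map_comp {U U' U'' V V' V'' : lmodType F}
    (f : {linear U -> U'}) (f' : {linear U' -> U''})
    (g : {linear V -> V'}) (g' : {linear V' -> V''}) :
  (f' ⊗ₗ g') \o (f ⊗ₗ g) =1 (f' \o f) ⊗ₗ (g' \o g).
Proof. by apply: tens_linear_ext => u v /=; rewrite !tens_mapE. Qed.

Lemma eq_tens_map {U U' V V' : lmodType F}
    (f f' : {linear U -> U'}) (g g' : {linear V -> V'}) :
  f =1 f' -> g =1 g' -> f ⊗ₗ g =1 f' ⊗ₗ g'.
Proof.
by move=> fE gE; apply: tens_linear_ext => u v; rewrite !tens_mapE fE gE.
Qed.

Lemma tens_assoc_nat {U U' V V' W W' : lmodType F} (f : {linear U -> U'})
    (g : {linear V -> V'}) (h : {linear W -> W'}) :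
  (f ⊗ₗ (g ⊗ₗ h)) \o tens_assoc U V W
    =1 tens_assoc U' V' W' \o ((f ⊗ₗ g) ⊗ₗ h).
Proof.
apply: tens_linear_ext => + w; elim/tens_ind => [u v|a b aE bE|k a aE].
- by rewrite /= tens_assocE !tens_mapE tens_assocE.
- by rewrite linearDl [LHS]linearD [RHS]linearD aE bE.
- by rewrite linearZl_LR [LHS]linearZ [RHS]linearZ aE.
Qed.

End TensorMapTheory.

Section Comodules.
Variables (F : fieldType) (H C : lmodType F).
Variables (muH : {linear H ⊗ H -> H}) (DeltaH : {linear H -> H ⊗ H}).
Variables (alphaH : {linear H -> H}) (alphaC : {linear C -> C}).
Variable delta : {linear C -> H ⊗ C}.

(** Applying alphaH^2 ⊗ (alphaH^2 ⊗ id) to both sides of the coassociativity axiom for [delta] gives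
    the one for [delta_tilde]: alphaH^2 commutes with [alphaH], and is compatible with [DeltaH] by
    [comul]. *)
Lemma hom_comodule_delta_tilde :
    DeltaH \o alphaH =1 (alphaH ⊗ₗ alphaH) \o DeltaH ->
    hom_comodule DeltaH alphaH alphaC delta ->
  hom_comodule DeltaH alphaH alphaC (delta_tilde alphaH delta).
Proof.
move=> comul [morph coA]; split=> c; rewrite /delta_tilde /=.
  rewrite -[delta (alphaC c)]morph /=.
  rewrite [LHS]tens_map_comp [RHS]tens_map_comp.
  exact: eq_tens_map.
rewrite [LHS]tens_map_comp.
transitivity (((alphaH \o alphaH) ⊗ₗ ((alphaH \o alphaH) ⊗ₗ idfun))
  ((alphaH ⊗ₗ delta) (delta c))).
  by rewrite [RHS]tens_map_comp; apply: eq_tens_map.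
rewrite [_ (delta c)]coA /= [LHS]tens_assoc_nat /=; congr (tens_assoc _ _ _ _).
rewrite [LHS]tens_map_comp [RHS]tens_map_comp.
apply: eq_tens_map => // h /=.
(* [comul] is used once for each of the two factors of alphaH^2. *)
by rewrite [RHS]comul /= [DeltaH _]comul [RHS]tens_map_comp.
Qed.

(* Both sides of the coassociativity axiom for [delta_CC] factor through
   [tens_coact_mul2]. *)
Definition tens_coact_mul : {linear (H ⊗ C) ⊗ (H ⊗ C) -> H ⊗ (C ⊗ C)} :=
  (muH ⊗ₗ idfun) \o mid_twist H C H C.
Definition tens_coact_mul2 :
    {linear (H ⊗ (H ⊗ C)) ⊗ (H ⊗ (H ⊗ C)) -> H ⊗ (H ⊗ (C ⊗ C))} :=
  (muH ⊗ₗ tens_coact_mul) \o mid_twist H (H ⊗ C)%type H (H ⊗ C)%type.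

Lemma tens_coact_mulE h c k d :
  tens_coact_mul ((h ⊗ₜ c) ⊗ₜ (k ⊗ₜ d)) = muH (h ⊗ₜ k) ⊗ₜ (c ⊗ₜ d).
Proof.
(* Conversion exposes the composite as nested applications, so that [mid_twistE] can match. *)
rewrite -[LHS]/(tens_map _ _ (mid_twist _ _ _ _ _)).
by rewrite mid_twistE tens_mapE.
Qed.

Lemma tens_coact_mul2E h x k y :
  tens_coact_mul2 ((h ⊗ₜ x) ⊗ₜ (k ⊗ₜ y))
    = muH (h ⊗ₜ k) ⊗ₜ tens_coact_mul (x ⊗ₜ y).
Proof.
rewrite -[LHS]/(tens_map _ _ (mid_twist _ _ _ _ _)).
by rewrite mid_twistE tens_mapE.
Qed.

(** [x] and [y] stay arbitrary because they will be coproducts [DeltaH h] and [DeltaH k], which are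
    not pure in general. On pure tensors h ⊗ h' and k ⊗ k' both sides are hk ⊗ (h'k' ⊗ (c ⊗ d)). *)
Lemma tens_coact_mul2_assoc c d (x y : H ⊗ H) :
  tens_assoc H H (C ⊗ C)%type
      ((muH ⊗ₗ muH) (mid_twist H H H H (x ⊗ₜ y)) ⊗ₜ (c ⊗ₜ d))
    = tens_coact_mul2 (tens_assoc H H C (x ⊗ₜ c) ⊗ₜ tens_assoc H H C (y ⊗ₜ d)).
Proof.
elim/tens_ind: x => [h h'|a b aE bE|k a aE].
- elim/tens_ind: y => [k k'|a b aE bE|k a aE].
  + rewrite mid_twistE tens_mapE !tens_assocE tens_coact_mul2E.
    by rewrite tens_coact_mulE.
  + by rewrite linearDr !linearD !linearDl !linearD linearDr linearD aE bE.
  + by rewrite linearZr_LR !linearZ !linearZl_LR !linearZ linearZr_LR linearZ aE.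
- by rewrite linearDl !linearD !linearDl !linearD linearDl linearD aE bE.
- by rewrite linearZl_LR !linearZ !linearZl_LR !linearZ linearZl_LR linearZ aE.
Qed.

Lemma hom_comodule_delta_CC :
    hom_bialgebra muH DeltaH alphaH ->
    hom_comodule DeltaH alphaH alphaC delta ->
  hom_comodule DeltaH alphaH (alphaC ⊗ₗ alphaC) (delta_CC muH delta).
Proof.
move=> [[mulE _] _ comulM] [morph coA].
have deltaE z : delta_CC muH delta z = tens_coact_mul ((delta ⊗ₗ delta) z) by [].
have coact_mul_alpha : (alphaH ⊗ₗ (alphaC ⊗ₗ alphaC)) \o tens_coact_mul
    =1 tens_coact_mul \o ((alphaH ⊗ₗ alphaC) ⊗ₗ (alphaH ⊗ₗ alphaC)).
  apply: tens_linear_ext4 => h c k d.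
  rewrite -[LHS]/(tens_map _ _ (tens_coact_mul _)).
  rewrite -[RHS]/(tens_coact_mul (tens_map _ _ _)).
  rewrite tens_coact_mulE !tens_mapE tens_coact_mulE.
  by rewrite [alphaH _]mulE /= tens_mapE.
have coact_mul_delta : (alphaH ⊗ₗ delta_CC muH delta) \o tens_coact_mul
    =1 tens_coact_mul2 \o ((alphaH ⊗ₗ delta) ⊗ₗ (alphaH ⊗ₗ delta)).
  apply: tens_linear_ext4 => h c k d.
  rewrite -[LHS]/(tens_map _ _ (tens_coact_mul _)).
  rewrite -[RHS]/(tens_coact_mul2 (tens_map _ _ _)).
  rewrite tens_coact_mulE !tens_mapE tens_coact_mul2E deltaE tens_mapE.
  by rewrite [alphaH _]mulE /= tens_mapE.
have coact_mul_comul :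
    tens_assoc H H (C ⊗ C)%type \o (DeltaH ⊗ₗ (alphaC ⊗ₗ alphaC))
      \o tens_coact_mul
    =1 tens_coact_mul2 \o ((tens_assoc H H C \o (DeltaH ⊗ₗ alphaC))
                        ⊗ₗ (tens_assoc H H C \o (DeltaH ⊗ₗ alphaC))).
  apply: tens_linear_ext4 => h c k d.
  rewrite -[LHS]/(tens_assoc _ _ _ (tens_map _ _ (tens_coact_mul _))).
  rewrite -[RHS]/(tens_coact_mul2 (tens_map _ _ _)).
  (* [comulM] turns the coproduct of the product hk into the product of the coproducts of h and
     k. *)
  rewrite tens_coact_mulE !tens_mapE [DeltaH _]comulM /= !tens_mapE.
  exact: tens_coact_mul2_assoc.
split=> z.
  rewrite [LHS]coact_mul_alpha /=; congr (tens_coact_mul _).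
  by rewrite [LHS]tens_map_comp [RHS]tens_map_comp; apply: eq_tens_map.
(* Once [tens_coact_mul2] is stripped, what remains is the tensor square of the axiom [coA] for
   [delta], evaluated at [z]. *)
rewrite [LHS]coact_mul_delta [RHS]coact_mul_comul /=; congr (tens_coact_mul2 _).
by rewrite [LHS]tens_map_comp [RHS]tens_map_comp; apply: eq_tens_map.
Qed.

End Comodules.

Theorem theorem1p1 (F : fieldType) (H C : lmodType F)
    (muH : {linear H ⊗ H -> H}) (DeltaH : {linear H -> H ⊗ H})
    (alphaH : {linear H -> H})
    (DeltaC : {linear C -> C ⊗ C}) (alphaC : {linear C -> C})
    (delta : {linear C -> H ⊗ C}) :
  hom_bialgebra muH DeltaH alphaH ->
  hom_coassoc_coalgebra DeltaC alphaC ->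
  hom_comodule DeltaH alphaH alphaC delta ->
  [/\ hom_comodule DeltaH alphaH alphaC (delta_tilde alphaH delta),
      hom_comodule DeltaH alphaH (alphaC ⊗ₗ alphaC) (delta_CC muH delta)
    & comodule_hom_coalgebra muH DeltaH alphaH DeltaC alphaC delta
      <-> hom_comodule_morphism alphaC (delta_tilde alphaH delta)
            (alphaC ⊗ₗ alphaC) (delta_CC muH delta) DeltaC].
Proof.
move=> bialgH coalgC comodC.
have tildeE : (idfun ⊗ₗ DeltaC) \o delta_tilde alphaH delta
    =1 ((alphaH \o alphaH) ⊗ₗ DeltaC) \o delta.
  by move=> c /=; rewrite [LHS]tens_map_comp; apply: eq_tens_map.
split.
- apply: hom_comodule_delta_tilde comodC.
  by case: bialgH => _ [].
- exact: hom_comodule_delta_CC.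
(* The fields other than the compatibility condition come from the hypotheses: the comodule axioms
   from [comodC], and compatibility of [DeltaC] with the twisting maps from [coalgC]. *)
- split=> [[_ comul]|[_ coact]]; split=> // c.
  + by rewrite [RHS](hom_comul coalgC).
  + by rewrite [RHS]tildeE comul.
  + by rewrite coact tildeE.
Qed.
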